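(* Let $n,a,b,p,q\ge 1$ be integers with $n=pa=qb$, and suppose that $[a^{p},b^{q},n]$ is a uniform passport (so that, by the standing assumption on passports, its genus $\frac{n-(p+q)+1}{2}$ is a non-negative integer). Then there exists a regular dessin d'enfant with passport $[a^{p},b^{q},n]$ if and only if $\gcd(p,q)=1$. The same statement holds for the passports $[a^{p},n,b^{q}]$ and $[n,a^{p},b^{q}]$.
   Context: A dessin d'enfant (dessin) is a connected, finite, bipartite graph (vertices colored black and white, each edge joining a black vertex to a white vertex) embedded as a map in a connected, compact, oriented surface without boundary, so that every face is homeomorphic to a disk. Let $E$ be its set of edges and $n=|E|$. Let $x$ (resp. $y$) be the permutation of $E$ sending each edge $e$ to the next edge counterclockwise around the unique black (resp. white) vertex incident to $e$. The monodromy group is $G=\langle x,y\rangle\le \mathrm{Sym}(E)$; it acts transitively on $E$. Permutations act on the left and are composed from right to left. The cycles of $x$, $y$ and $(xy)^{-1}$ correspond to the black vertices, white vertices and faces, and the cycle lengths are their valencies. Conversely, any pair of permutations $x,y$ of an $n$-element set generating a transitive group arises in this way from a dessin. The passport of a dessin with $n$ edges is the triple $[\lambda_0,\lambda_1,\lambda_\infty]$ of partitions of $n$ given by the valencies of black vertices, white vertices and faces (equivalently the cycle types of $x$, $y$, $(xy)^{-1}$). Its genus is $g=\frac{n-(l(\lambda_0)+l(\lambda_1)+l(\lambda_\infty))}{2}+1$, where $l(\lambda)$ is the number of parts of $\lambda$; standing assumption: for any triple called a passport, $g$ is a non-negative integer. The notation $a^{p}$ denotes the partition with $p$ parts all equal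 to $a$, and $n$ stands for $n^{1}$. A passport is uniform if it has the form $[a^{p},b^{q},c^{r}]$ with $n=pa=qb=rc$. A dessin is regular if its monodromy group acts freely (hence regularly) on its set of edges. *)

(* Defs.v *)
From mathcomp Require Import all_boot all_order all_algebra all_fingroup.

Set Implicit Arguments.
Unset Strict Implicit.
Unset Printing Implicit Defensive.

Import GRing.Theory Num.Theory.

(* A dessin d'enfant is encoded by its edge set and its two rotations: x (resp.
   y) sends an edge to the next one counterclockwise around its black (resp.
   white) endpoint. Connectedness of the graph is transitivity of <x, y>;
   MathComp's transitivity also forces the edge set to be nonempty. *)
Record dessin := Dessin {
  edge : finType;
  rot_black : {perm edge};
  rot_white : {perm edge};
  dessin_connected :
    [transitive <<[set rot_black; rot_white]>>, on [set: edge] | 'P]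
}.

Definition monodromy (D : dessin) : {group {perm edge D}} :=
  <<[set rot_black D; rot_white D]>>%G.

(* Permutations of a dessin compose from right to left, e |-> x (y e) for x y,
   whereas in MathComp (s * t) e = t (s e); hence the order of the factors. *)
Definition rot_face (D : dessin) : {perm edge D} :=
  ((rot_white D * rot_black D)^-1)%g.

Definition is_partition (n : nat) (l : seq nat) : bool :=
  [&& sorted geq l, all (fun k => 0 < k) l & sumn l == n].

(* Fixed points count as cycles of length 1. *)
Definition cycle_type (T : finType) (s : {perm T}) : seq nat :=
  sort geq [seq #|C| | C : {set T} <- enum (porbits s)].

(* The partitions attached to the black vertices, the white vertices and the
   faces, in this order. *)
Definition partition_triple := (seq nat * seq nat * seq nat)%type.

Definition genus (n : nat) (P : partition_triple) : rat :=
  let: (l0, l1, loo) := P in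
  ((n%:R - (size l0 + size l1 + size loo)%:R) / 2 + 1)%R.

Definition is_passport (n : nat) (P : partition_triple) : Prop :=
  let: (l0, l1, loo) := P in
  [/\ is_partition n l0, is_partition n l1, is_partition n loo
    & genus n P \is a Num.nat].

Definition is_uniform_passport (n : nat) (P : partition_triple) : Prop :=
  is_passport n P /\
  exists a b c p q r : nat,
    [/\ P = (nseq p a, nseq q b, nseq r c), n = p * a, n = q * b & n = r * c].

Definition passport (D : dessin) : partition_triple :=
  (cycle_type (rot_black D), cycle_type (rot_white D),
   cycle_type (rot_face D)).

Definition is_regular (D : dessin) : Prop :=
  forall (g : {perm edge D}) (e : edge D),
    g \in monodromy D -> g e = e -> g = 1%g.

Definition has_regular_dessin (P : partition_triple) : Prop :=
  exists D : dessin, is_regular D /\ passport D = P.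

(* Main.v *)
Require Import Defs.
From mathcomp Require Import all_boot all_order all_algebra all_fingroup.
From mathcomp Require Import cyclic zify ring.

(** If the dessin is regular, its monodromy group has order n; the rotation with
    a single cycle of length n generates it, so the group is cyclic of order n
    and its exponent n divides lcm(a, b) = n / gcd(p, q). Conversely, when
    gcd(p, q) = 1, take the regular representation of a cyclic group <g> of
    order n with rotations g^p and g^(q v), where v and p + q v are prime to n.
    Such a v is obtained by requiring v = 1 modulo the primes not dividing
    p + q, and v = -1 modulo those dividing p + q; this fails only at the prime
    2 when n is even and p, q are odd, which integrality of the genus forbids. *)

(** Freeness makes the stabilizer of [e] in the cyclic group of [s] trivial, so orbit-stabilizer
    applies; hence all cycles of [s] have the same length. *)
Lemma regular_porbit_card (D : dessin) (s : {perm edge D}) (e : edge D) :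
  is_regular D -> s \in monodromy D -> #|porbit s e| = #[s]%g.
Proof.
move=> regD sG.
have := @card_orbit_stab _ _ 'P%act <[s]>%G e.
suff -> : 'C_(<[s]>)[e | 'P]%g = 1%g.
  by rewrite cards1 muln1 -porbitE => ->.
apply/trivgP/subsetP => t /setIP[ts /astab1P te].
apply/set1P/(regD t e) => //.
by apply: subsetP ts; rewrite cycle_subG.
Qed.

Lemma sum_card_porbits (T : finType) (s : {perm T}) :
  \sum_(C in porbits s) #|C| = #|T|.
Proof.
have -> : porbits s = orbit 'P <[s]>%g @: [set: T].
  by apply/setP=> C; apply/imsetP/imsetP => -[x _ ->]; exists x;
     rewrite ?inE // porbitE.
rewrite -cardsT; apply/esym/card_partition/orbit_partition.
by apply/actsP => t _ x; rewrite !inE.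
Qed.

Lemma regular_cycle_type (D : dessin) (s : {perm edge D}) :
  is_regular D -> s \in monodromy D ->
  cycle_type s = nseq (#|edge D| %/ #[s]%g) #[s]%g.
Proof.
move=> regD sG.
have cards C : C \in porbits s -> #|C| = #[s]%g.
  by move=> /imsetP[e _ ->]; apply: regular_porbit_card.
have -> : #|edge D| %/ #[s]%g = size (cycle_type s).
  rewrite -(@sum_card_porbits _ s) (eq_bigr (fun=> #[s]%g)) //.
  by rewrite sum_nat_const mulnK ?order_gt0 // size_sort size_map -cardE.
apply/all_pred1P; rewrite all_sort all_map.
by apply/allP => C; rewrite mem_enum /= => /cards ->.
Qed.

(** Used to read orders and the number of edges off a passport. Positivity of [k] matters: an empty
    [nseq] would not determine [c]. *)
Lemma regular_cycle_type_nseq (D : dessin) (s : {perm edge D}) (k c : nat) :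
  is_regular D -> s \in monodromy D -> 0 < k ->
  cycle_type s = nseq k c -> #[s]%g = c /\ #|edge D| = k * c.
Proof.
move=> regD sG; case: k => // k _; rewrite regular_cycle_type // => eq_ct.
have sE : #[s]%g %| #|edge D|.
  rewrite -(@sum_card_porbits _ s); apply: dvdn_sum => C /imsetP[e _ ->].
  by rewrite regular_porbit_card.
have /(congr1 size) := eq_ct; rewrite !size_nseq => eq_k.
move: eq_ct; rewrite eq_k => -[eq_c]; split=> //.
by rewrite -eq_c -eq_k divnK.
Qed.

Lemma regular_card_monodromy (D : dessin) :
  is_regular D -> #|monodromy D| = #|edge D|.
Proof.
move=> regD; have trD := dessin_connected D.
have /imsetP[e _ orbE] := trD.
have := @card_orbit_stab _ _ 'P%act (monodromy D) e.
rewrite -orbE cardsT.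
suff -> : 'C_(monodromy D)[e | 'P]%g = 1%g by rewrite cards1 muln1.
apply/trivgP/subsetP => t /setIP[tG /astab1P te].
exact/set1P/(regD t e).
Qed.

Lemma rot_black_in (D : dessin) : rot_black D \in monodromy D.
Proof. by apply: mem_gen; rewrite !inE eqxx. Qed.

Lemma rot_white_in (D : dessin) : rot_white D \in monodromy D.
Proof. by apply: mem_gen; rewrite !inE eqxx orbT. Qed.

Lemma rot_face_in (D : dessin) : rot_face D \in monodromy D.
Proof. by rewrite groupV groupM // ?rot_black_in ?rot_white_in. Qed.

(** By commutation, the order n of the product divides lcm(a, b). Both a = n/p and b = n/q divide
    n/d with d = gcd(p, q), so n divides n/d and d = 1. An arbitrary commuting pair is allowed so
    that any two of the three rotations can be used. *)
Lemma order_cofactors_coprime (gT : finGroupType) (s t : gT)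
    (n a b p q : nat) :
  commute s t -> 0 < n -> n = p * a -> n = q * b ->
  #[s]%g = a -> #[t]%g = b -> #[(s * t)^-1]%g = n -> gcdn p q = 1.
Proof.
move=> cst n0 npa nqb sa tb stn.
have n_dvd : n %| lcmn a b.
  rewrite -stn orderV order_dvdn expgMn //.
  have /eqP-> : (s ^+ lcmn a b == 1)%g by rewrite -order_dvdn sa dvdn_lcml.
  have /eqP-> : (t ^+ lcmn a b == 1)%g by rewrite -order_dvdn tb dvdn_lcmr.
  by rewrite mulg1.
set d := gcdn p q.
have dn : d %| n by rewrite npa dvdn_mulr // dvdn_gcdl.
have lcm_dvd : lcmn a b %| n %/ d.
  rewrite dvdn_lcm {1}npa nqb.
  by rewrite !(mulnC _ a, mulnC _ b) -!muln_divA ?dvdn_gcdl ?dvdn_gcdr //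
     !dvdn_mulr.
have := dvdn_trans n_dvd lcm_dvd.
have d0 : 0 < d by apply: dvdn_gt0 dn.
move/dvdn_leq; rewrite divn_gt0 // => /(_ (dvdn_leq n0 dn)).
rewrite leq_divRL // -{2}[n]muln1 leq_pmul2l //; lia.
Qed.

(** The edges are the group elements, and the group acts on them by right translations, freely and
    transitively. The product [y * x] follows the order of factors in [rot_face]. *)
Lemma regular_dessin_of_generators (gT : finGroupType) (x y : gT) :
  <<[set x; y]>>%g = [set: gT] ->
  has_regular_dessin
    (nseq (#|gT| %/ #[x]%g) #[x]%g, nseq (#|gT| %/ #[y]%g) #[y]%g,
     nseq (#|gT| %/ #[(y * x)^-1]%g) #[(y * x)^-1]%g).
Proof.
move=> genxy.
pose r := [morphism of actperm ('R : {action gT &-> gT})].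
have rE (g e : gT) : r g e = (e * g)%g by rewrite /= actpermE.
have gen_r : <<[set r x; r y]>>%g = (r @* [set: gT])%g.
  transitivity (r @* <<[set x; y]>>)%g; last by congr (_ @* _)%g.
  by rewrite morphim_gen ?subsetT // morphimEsub ?subsetT // imsetU !imset_set1.
have r_order (g : gT) : #[r g]%g = #[g]%g.
  apply: order_injm; rewrite ?inE //.
  apply/injmP => h k _ _ /permP/(_ 1%g).
  by rewrite !rE !mul1g.
have tr : [transitive <<[set r x; r y]>>, on [set: gT] | 'P]%g.
  apply/imsetP; exists 1%g; rewrite ?inE //; apply/esym/setP => e.
  rewrite inE; apply/orbitP; exists (r e).
    by rewrite gen_r mem_morphim ?inE.
  by rewrite /= apermE rE mul1g.
pose D := Dessin tr.
have regD : is_regular D.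
  move=> s e; rewrite /= gen_r => /morphimP[g _ _ ->].
  rewrite rE => /(canRL (mulKg _)); rewrite mulVg => ->.
  exact: morph1.
exists D; split=> //; rewrite /passport.
rewrite !regular_cycle_type ?rot_black_in ?rot_white_in ?rot_face_in //.
have -> : rot_face D = r (y * x)^-1%g.
  by rewrite morphV ?inE // morphM ?inE.
by rewrite !r_order.
Qed.

Lemma coprime_shift_exists (n p q : nat) :
  0 < n -> coprime p q -> ~~ [&& ~~ odd n, odd p & odd q] ->
  exists v, coprime n v /\ coprime n (p + q * v).
Proof.
move=> n0 cpq par.
pose m := n`_(\pi(p + q)); pose m' := n`_(\pi(p + q))^'.
have nE : n = m * m' by rewrite partnC.
have cmm' : coprime m m' by apply: coprime_partC.
have m0 : 0 < m by apply: part_gt0.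
(* [m.-1] represents -1, so p + q v is p - q modulo [m], and p + q modulo [m']. *)
have [v vm vm'] : exists2 v, v = m.-1 %[mod m] & v = 1 %[mod m'].
  by exists (chinese m m' m.-1 1); [apply: chinese_modl | apply: chinese_modr].
have dvd_v1 l : l %| m -> l %| v.+1.
  move=> lm; rewrite -addn1 /dvdn; apply/eqP.
  have -> : v + 1 = m.-1 + 1 %[mod l].
    by rewrite -modnDml -(modn_dvdm v lm) vm modn_dvdm // modnDml.
  by rewrite addn1 prednK //; apply/eqP.
have v_mod1 l : l %| m' -> v = 1 %[mod l].
  by move=> lm; rewrite -(modn_dvdm v lm) vm' modn_dvdm.
have prime_cop k : (forall l, prime l -> l %| n -> ~~ (l %| k)) -> coprime n k.
  move=> H; apply/negPn/negP => ncop.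
  have /pdivP[l pl] : 1 < gcdn n k by rewrite ltn_neqAle eq_sym ncop gcdn_gt0 n0.
  by rewrite dvdn_gcd => /andP[ln]; apply/negP/H.
exists v; split; apply: prime_cop => l pl ln.
  apply/negP => lv; move: ln; rewrite nE Euclid_dvdM // => /orP[/dvd_v1|/v_mod1].
    by rewrite -addn1 dvdn_addr // Euclid_dvd1.
  by move/eqP: lv => -> /esym/eqP; rewrite -/(dvdn l 1) Euclid_dvd1.
apply/negP => lpqv; have := ln; rewrite {1}nE Euclid_dvdM // => /orP[lm|lm'].
  have lpq : l %| p + q.
    have /pnatP/(_ l pl lm) : \pi(p + q).-nat m by apply: part_pnat.
    by rewrite mem_primes => /(_ m0)/and3P[].
  have lqv : l %| q * v.+1 by rewrite dvdn_mull // dvd_v1.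
  have l2p : l %| 2 * p.
    (* The congruence 2p = (p + q) + (p - q), kept free of subtraction by adding q (v + 1), a
       multiple of [l]. *)
    have e : 2 * p + q * v.+1 = (p + q) + (p + q * v) by rewrite mulnS; ring.
    by rewrite -(dvdn_addl _ lqv) e dvdn_add.
  have l2q : l %| 2 * q.
    by rewrite -(dvdn_addr _ l2p) -mulnDr dvdn_mull.
  have : l %| 2.
    have <- : gcdn (2 * p) (2 * q) = 2 by rewrite -muln_gcdr (eqP cpq).
    by rewrite dvdn_gcd l2p.
  (* Now n and p + q are even, so p and q have the same parity: both odd contradicts [par], both
     even contradicts coprimality. *)
  rewrite dvdn_prime2 // => /eqP l2; move: par lpq cpq ln; rewrite l2 !dvdn2.
  rewrite oddD => par pq cpq nn; move: par pq; rewrite nn /=.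
  case po: (odd p); case qo: (odd q) => // _ _.
  by have := dvdn_gcd 2 p q; rewrite (eqP cpq) !dvdn2 po qo.
have lpq : l %| p + q.
  move: lpqv; rewrite /dvdn -modnDmr -modnMmr (v_mod1 _ lm') modnMmr modnDmr.
  by rewrite muln1.
have m'0 : 0 < m' by apply: part_gt0.
have /pnatP/(_ l pl lm') : (\pi(p + q))^'.-nat m' by apply: part_pnat.
move=> /(_ m'0); rewrite inE /= mem_primes pl lpq andbT /=.
(* The set of primes of 0 is empty by convention, so p + q = 0 is treated apart: then p = q = 0,
   whose gcd is 0. *)
have := cpq; case: (p + q =P 0) => [|/eqP]; last by rewrite -lt0n => ->.
by move=> /eqP; rewrite addn_eq0 => /andP[/eqP-> /eqP->].
Qed.

(** Twice the genus is n - s + 2, with s the total number of parts; integrality of the genus makes n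
    - s even. *)
Lemma passport_parity (n : nat) (l0 l1 loo : seq nat) :
  is_passport n (l0, l1, loo) ->
  odd n = odd (size l0 + size l1 + size loo).
Proof.
move=> [_ _ _] /Num.Theory.natrP[k]; rewrite /genus.
move: (_ + size loo) => s gk.
have : ((n + 2)%:R = (k * 2 + s)%:R :> rat)%R.
  by rewrite !GRing.natrD GRing.natrM -gk; field.
move=> /eqP; rewrite Num.Theory.eqr_nat => /eqP; lia.
Qed.

(** In a cyclic group generated by g, the powers g^p and g^(q v) have orders n/p = a and n/q = b, as
    v is prime to n. Their product g^(p + q v) is again a generator because p + q v is prime to
    n. *)
Lemma cyclic_generators_exist (n a b p q : nat) :
  0 < n -> n = p * a -> n = q * b -> gcdn p q = 1 -> odd n = odd (p + q + 1) ->
  exists gT : finGroupType, exists x y : gT,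
    [/\ #|gT| = n, <[(y * x)^-1]>%g = [set: gT], commute x y,
        #[x]%g = a & #[y]%g = b].
Proof.
case: n => // n _ npa nqb /eqP cpq par.
have [||v [nv npqv]] := @coprime_shift_exists n.+1 p q _ cpq => //.
  by move: par; rewrite !oddD; case: (odd n.+1) (odd p) (odd q) => [] [] [].
have [p0 q0] : 0 < p /\ 0 < q by lia.
(* The ordinals below [n.+1] form the additive group of integers modulo [n.+1], with generator
   [Zp1]. *)
pose g : 'I_n.+1 := Zp1.
have gT : <[g]>%g = [set: 'I_n.+1] by rewrite Zp_cycle.
have og : #[g]%g = n.+1 by rewrite orderE gT cardsT card_ord.
exists 'I_n.+1, (g ^+ p)%g, (g ^+ (q * v))%g; split.
- by rewrite card_ord.
- apply/eqP; rewrite eqEcard subsetT /= cardsT card_ord -[#|<[_]>%g|]orderE.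
  by rewrite orderV -expgD orderXgcd og addnC (eqP npqv) divn1.
- exact/commuteX2.
- by rewrite orderXgcd og npa gcdnC gcdnMr mulKn.
- by rewrite orderXgcd og Gauss_gcdl // nqb gcdnC gcdnMr mulKn.
Qed.

Theorem theorem6p1 (n a b p q : nat)
    (hn : 1 <= n) (ha : 1 <= a) (hb : 1 <= b) (hp : 1 <= p) (hq : 1 <= q)
    (hpa : n = p * a) (hqb : n = q * b) :
  [/\ is_uniform_passport n (nseq p a, nseq q b, nseq 1 n) ->
        (has_regular_dessin (nseq p a, nseq q b, nseq 1 n) <-> gcdn p q = 1),
      is_uniform_passport n (nseq p a, nseq 1 n, nseq q b) ->
        (has_regular_dessin (nseq p a, nseq 1 n, nseq q b) <-> gcdn p q = 1)
    & is_uniform_passport n (nseq 1 n, nseq p a, nseq q b) ->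
        (has_regular_dessin (nseq 1 n, nseq p a, nseq q b) <-> gcdn p q = 1)].
Proof.
have na : n %/ a = p by rewrite hpa mulnK.
have nb : n %/ b = q by rewrite hqb mulnK.
have nn : n %/ n = 1 by rewrite divnn hn.
(* The monodromy group has as many elements as there are edges, so a rotation of that order
   generates it. *)
have abelianG (D : dessin) (s : {perm edge D}) : is_regular D ->
    s \in monodromy D -> #[s]%g = #|edge D| -> abelian (monodromy D).
  move=> regD sG os; suff <- : <[s]>%g = monodromy D by apply: cycle_abelian.
  apply/eqP; rewrite eqEcard cycle_subG sG /= -orderE os.
  by rewrite regular_card_monodromy.
have gen_all (gT : finGroupType) (g x y : gT) : <[g]>%g = [set: gT] ->
    g \in <<[set x; y]>>%g -> <<[set x; y]>>%g = [set: gT].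
  move=> gT_g gxy; apply/eqP; rewrite eqEsubset subsetT /= -gT_g.
  by rewrite cycle_subG.
split=> -[pass _]; have par := passport_parity _ _ _ _ pass;
  rewrite !size_nseq in par; split.
- move=> [D [regD [xa yb fn]]].
  have [ox _] := regular_cycle_type_nseq _ _ _ _ regD (rot_black_in D) hp xa.
  have [oy _] := regular_cycle_type_nseq _ _ _ _ regD (rot_white_in D) hq yb.
  have [of_ En] :=
    regular_cycle_type_nseq _ _ 1 _ regD (rot_face_in D) isT fn.
  rewrite mul1n in En.
  have cG := abelianG _ _ regD (rot_face_in D) (etrans of_ (esym En)).
  have cxy := centsP cG _ (rot_black_in D) _ (rot_white_in D).
  apply: (order_cofactors_coprime _ _ _ n a b p q cxy) => //.
  by rewrite cxy.
- move=> gpq.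
  have [//|gT [x [y [cT gT_z cxy ox oy]]]] :=
    cyclic_generators_exist n a b p q hn hpa hqb gpq.
  have oz : #[(y * x)^-1]%g = n by rewrite orderE gT_z cardsT.
  have := @regular_dessin_of_generators gT x y.
  rewrite cT ox oy oz na nb nn; apply.
  apply: gen_all gT_z _.
  by rewrite groupV groupM // mem_gen // !inE eqxx ?orbT.
- move=> [D [regD [xa yn fb]]].
  have [ox _] := regular_cycle_type_nseq _ _ _ _ regD (rot_black_in D) hp xa.
  have [of_ _] := regular_cycle_type_nseq _ _ _ _ regD (rot_face_in D) hq fb.
  have [oy En] :=
    regular_cycle_type_nseq _ _ 1 _ regD (rot_white_in D) isT yn.
  rewrite mul1n in En.
  have cG := abelianG _ _ regD (rot_white_in D) (etrans oy (esym En)).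
  have cxf := centsP cG _ (rot_black_in D) _ (rot_face_in D).
  (* The inverse of the product of the black and face rotations is the white one, of order n. *)
  apply: (order_cofactors_coprime _ _ _ n a b p q cxf) => //.
  by rewrite /rot_face invMg invgK mulgK.
- move=> gpq.
  have [|gT [x [y [cT gT_z cxy ox oy]]]] :=
    cyclic_generators_exist n a b p q hn hpa hqb gpq; first by lia.
  have oz : #[(y * x)^-1]%g = n by rewrite orderE gT_z cardsT.
  (* Taking the generator as white rotation moves [y] to the faces. *)
  have := @regular_dessin_of_generators gT x (y * x)^-1%g.
  have -> : (((y * x)^-1 * x)^-1 = y)%g.
    by rewrite invMg invgK -cxy mulKg.
  rewrite cT ox oy oz na nb nn; apply.
  apply: gen_all gT_z _.
  by rewrite mem_gen // !inE eqxx ?orbT.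
- move=> [D [regD [xn ya fb]]].
  have [oy _] := regular_cycle_type_nseq _ _ _ _ regD (rot_white_in D) hp ya.
  have [of_ _] := regular_cycle_type_nseq _ _ _ _ regD (rot_face_in D) hq fb.
  have [ox En] :=
    regular_cycle_type_nseq _ _ 1 _ regD (rot_black_in D) isT xn.
  rewrite mul1n in En.
  have cG := abelianG _ _ regD (rot_black_in D) (etrans ox (esym En)).
  have cfy := centsP cG _ (rot_white_in D) _ (rot_face_in D).
  (* Commutation turns the inverse of this product into the black rotation, of order n. *)
  apply: (order_cofactors_coprime _ _ _ n a b p q cfy) => //.
  by rewrite cfy /rot_face invMg invgK mulKg.
- move=> gpq.
  have [|gT [x [y [cT gT_z cxy ox oy]]]] :=
    cyclic_generators_exist n a b p q hn hpa hqb gpq; first by lia.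
  have oz : #[(y * x)^-1]%g = n by rewrite orderE gT_z cardsT.
  (* With the generator as black rotation and [x] as white one, the faces again receive [y]. *)
  have := @regular_dessin_of_generators gT (y * x)^-1%g x.
  have -> : ((x * (y * x)^-1)^-1 = y)%g.
    by rewrite invMg invgK mulgK.
  rewrite cT ox oy oz na nb nn; apply.
  apply: gen_all gT_z _.
  by rewrite mem_gen // !inE eqxx ?orbT.
Qed.
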